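(* Let $\beta(s)=\hat\beta+sK_1^{-1}\delta$ for $s\in\mathbb R$, and for $\alpha=1,\dots,p$ let $s_\alpha$ be the value of the parameter $s$ such that $\beta_\alpha(s_\alpha)=0$, that is, $$s_\alpha=\frac{-\Delta\,\hat\beta_\alpha}{\sum_{j=1}^pK_1^{j\alpha}\delta^j},\qquad \alpha=1,\dots,p.$$ Let $s_I$ be the one of $s_1,\dots,s_p$ that is negative and has the minimal absolute value among all the negative values of $s_\alpha$. Then for all $s$ such that $s_I<s<0$, the solution of the lasso is given by $\beta(s)=\hat\beta+sK_1^{-1}\delta$, where $s$ and the lasso bound $t$ are related by $\|\beta(s)\|_1=t$.
   Context: Let $p\ge2$. A data set consists of $N$ points $(x_1^{(i)},\dots,x_p^{(i)},y^{(i)})\in\mathbb R^{p+1}$ with centroid at the origin and not contained in any proper affine subspace (full rank assumption). Put $K_1=\frac1N\sum_i x^{(i)}(x^{(i)})^T$ ($p\times p$, positive definite), $b=\frac1N\sum_i y^{(i)}x^{(i)}\in\mathbb R^p$, $\hat\beta=K_1^{-1}b$, $\hat t=\|\hat\beta\|_1$. For $t\ge0$ the solution of the lasso (lasso estimate) is the unique minimizer of $f(\beta)=\frac12\sum_i\big(y^{(i)}-\sum_j\beta_jx_j^{(i)}\big)^2$ over $\beta\in\mathbb R^p$ with $\|\beta\|_1=\sum_j|\beta_j|\le t$. The vector $\delta=(\delta^1,\dots,\delta^p)$ is the vector of signs of $\hat\beta$, so that $\hat t=\sum_{j=1}^p\delta^j\hat\beta_j$ and $\delta^j\hat\beta_j\ge0$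 for all $j=1,\dots,p$. $\Delta=\det K_1$ and $K_1^{j\alpha}$ is the $(j,\alpha)$-cofactor of $K_1$.
   Formalization: The formal theorem additionally assumes that β̂_α ≠ 0 for every α whose denominator Σ_j K_1^{jα}δ^j is non-zero (no well-defined s_α equals 0); without this the claim fails, e.g. K_1 = [[1,1/2],[1/2,1]], β̂ = (1,0), δ = (1,1). *)

(* Defs.v *)
From HB Require Import structures.
From mathcomp Require Import all_boot all_order all_algebra.
From mathcomp Require Import reals.

Set Implicit Arguments.
Unset Strict Implicit.
Unset Printing Implicit Defensive.

Import Order.TTheory GRing.Theory Num.Theory.
Local Open Scope ring_scope.

(* The point (x^(i)_1, ..., x^(i)_p, y^(i)) of R^(p+1). *)
Definition data_point (R : realType) (p N : nat)
    (x : 'I_N -> 'cV[R]_p) (y : 'I_N -> R) (i : 'I_N) : 'cV[R]_(p + 1) :=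
  col_mx (x i) (y i)%:M.

Definition centered (R : realType) (p N : nat)
    (x : 'I_N -> 'cV[R]_p) (y : 'I_N -> R) : Prop :=
  N%:R^-1 *: (\sum_(i < N) data_point x y i) = 0.

(* An affine subspace is a translate a + V of a linear subspace V; it is proper
   when V is not the whole space. *)
Definition full_rank (R : realType) (p N : nat)
    (x : 'I_N -> 'cV[R]_p) (y : 'I_N -> R) : Prop :=
  forall (a : 'cV[R]_(p + 1)) (V : {vspace 'cV[R]_(p + 1)}),
    (forall i, data_point x y i - a \in V) -> V = fullv.

Definition K1 (R : realType) (p N : nat) (x : 'I_N -> 'cV[R]_p) : 'M[R]_p :=
  N%:R^-1 *: (\sum_(i < N) x i *m (x i)^T).

Definition bvec (R : realType) (p N : nat)
    (x : 'I_N -> 'cV[R]_p) (y : 'I_N -> R) : 'cV[R]_p :=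
  N%:R^-1 *: (\sum_(i < N) y i *: x i).

Definition betahat (R : realType) (p N : nat)
    (x : 'I_N -> 'cV[R]_p) (y : 'I_N -> R) : 'cV[R]_p :=
  invmx (K1 x) *m bvec x y.

Definition l1norm (R : realType) (p : nat) (beta : 'cV[R]_p) : R :=
  \sum_(j < p) `|beta j 0|.

Definition lasso_loss (R : realType) (p N : nat)
    (x : 'I_N -> 'cV[R]_p) (y : 'I_N -> R) (beta : 'cV[R]_p) : R :=
  2^-1 * \sum_(i < N) (y i - \sum_(j < p) beta j 0 * x i j 0) ^+ 2.

Definition lasso_minimizer (R : realType) (p N : nat)
    (x : 'I_N -> 'cV[R]_p) (y : 'I_N -> R) (t : R) (beta : 'cV[R]_p) : Prop :=
  l1norm beta <= t /\
  forall gamma : 'cV[R]_p, l1norm gamma <= t ->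
    lasso_loss x y beta <= lasso_loss x y gamma.

Definition lasso_solution (R : realType) (p N : nat)
    (x : 'I_N -> 'cV[R]_p) (y : 'I_N -> R) (t : R) (beta : 'cV[R]_p) : Prop :=
  unique (lasso_minimizer x y t) beta.

(* The sign of a zero entry is left free in {-1, 0, 1}, so as not to depend on
   a convention; in all cases delta_j * beta_j = `|beta_j|. *)
Definition sign_vector (R : realType) (p : nat) (delta beta : 'cV[R]_p) : Prop :=
  forall j : 'I_p,
    (beta j 0 != 0 -> delta j 0 = Num.sg (beta j 0)) /\
    (beta j 0 = 0 -> delta j 0 \in [:: -1; 0; 1]).

Definition beta_line (R : realType) (p N : nat)
    (x : 'I_N -> 'cV[R]_p) (y : 'I_N -> R) (delta : 'cV[R]_p) (s : R)
    : 'cV[R]_p :=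
  betahat x y + s *: (invmx (K1 x) *m delta).

(* \det K1 times the slope of the alpha-th coordinate of beta_line. *)
Definition s_denom (R : realType) (p N : nat)
    (x : 'I_N -> 'cV[R]_p) (delta : 'cV[R]_p) (alpha : 'I_p) : R :=
  \sum_(j < p) cofactor (K1 x) j alpha * delta j 0.

(* When s_denom vanishes, the alpha-th coordinate of beta_line is constant and
   there is no s_alpha; s_value is then 0 (division by 0), hence never one of
   the negative values. *)
Definition s_value (R : realType) (p N : nat)
    (x : 'I_N -> 'cV[R]_p) (y : 'I_N -> R) (delta : 'cV[R]_p) (alpha : 'I_p)
    : R :=
  - \det (K1 x) * betahat x y alpha 0 / s_denom x delta alpha.

(* Main.v *)
(* Since [K1 beta(s) = b + s delta], the gradient of the loss at [beta(s)] is
   [N s delta], so for every [gamma]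
   [f(gamma) = f(beta(s)) + N s <delta, gamma - beta(s)>
               + 1/2 sum_i <x_i, gamma - beta(s)>^2].
   For [s_I < s < 0] no coordinate of [beta(s)] has changed sign, hence
   [<delta, beta(s)> = t >= |gamma|_1 >= <delta, gamma>] for every admissible
   [gamma]: the linear term is nonnegative, and the quadratic term vanishes
   only at [gamma = beta(s)] by the full rank assumption. *)
Require Import Defs.
From HB Require Import structures.
From mathcomp Require Import all_boot all_order all_algebra.
From mathcomp Require Import reals.
From mathcomp Require Import ring lra.

Import Order.TTheory GRing.Theory Num.Theory.
Local Open Scope ring_scope.

(** The data points lie in the kernel of the functional (u, w) |-> v^T u on R^(p+1), which ignores
    the response w. Full rank makes this kernel the whole space, so the functional is zero. *)
Lemma full_rank_orthogonal_eq0 {R : realType} {p N : nat}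
    {x : 'I_N -> 'cV[R]_p} {y : 'I_N -> R} {v : 'cV[R]_p} :
  full_rank x y -> (forall i, \sum_(j < p) v j 0 * x i j 0 = 0) -> v = 0.
Proof.
move=> hfull vx0.
pose V : {vspace 'cV[R]_(p + 1)} := lker (linfun (mulmx (row_mx v^T (0 : 'M[R]_1)))).
have kerV : V = fullv.
  apply: (hfull 0) => i; rewrite subr0 memv_ker lfunE /=.
  rewrite mul_row_col mul0mx addr0; apply/eqP/matrixP => a b.
  rewrite !ord1 !mxE -[RHS](vx0 i).
  by apply: eq_bigr => j _; rewrite mxE.
apply/colP => j; rewrite mxE.
(* The functional evaluated at the j-th basis vector is v_j. *)
have := memvf (col_mx (delta_mx j 0) 0 : 'cV[R]_(p + 1)).
rewrite -kerV memv_ker lfunE /= mul_row_col mul0mx addr0 -colE.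
by move/eqP/matrixP/(_ 0 0); rewrite !mxE.
Qed.

(** Without data points the zero subspace would contain all of them, yet R^(p+1) is nonzero. *)
Lemma full_rank_gt0 {R : realType} {p N : nat}
    {x : 'I_N -> 'cV[R]_p} {y : 'I_N -> R} : full_rank x y -> (0 < N)%N.
Proof.
case: N x y => [|//] x y hfull.
have V0 : 0%VS = fullv :> {vspace 'cV[R]_(p + 1)}.
  by apply: (hfull 0) => - [].
have := memvf (const_mx 1 : 'cV[R]_(p + 1)).
rewrite -V0 memv0 => /eqP/matrixP/(_ (rshift p 0) 0).
by rewrite !mxE => /eqP; rewrite oner_eq0.
Qed.

Lemma K1_mulE {R : realType} {p N : nat} (x : 'I_N -> 'cV[R]_p)
    (v : 'cV[R]_p) (j : 'I_p) : (0 < N)%N ->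
  N%:R * (K1 x *m v) j 0 = \sum_(i < N) (\sum_(k < p) v k 0 * x i k 0) * x i j 0.
Proof.
move=> N0; have NR : (N%:R : R) != 0 by rewrite pnatr_eq0 -lt0n.
rewrite /K1 -scalemxAl mxE mulVKf // mulmx_suml summxE.
apply: eq_bigr => i _; rewrite -mulmxA mxE big_ord1 mulrC; congr (_ * _).
by rewrite mxE; apply: eq_bigr => k _; rewrite mxE mulrC.
Qed.

(** If K1 v = 0, then 0 = N v^T K1 v = sum_i <v, x_i>^2, so v is orthogonal to every x_i. *)
Lemma K1_unit {R : realType} {p N : nat}
    {x : 'I_N -> 'cV[R]_p} {y : 'I_N -> R} : full_rank x y -> K1 x \in unitmx.
Proof.
move=> hfull; rewrite -unitmx_tr -row_free_unit.
apply: inj_row_free => u uK0; apply: trmx_inj; rewrite trmx0.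
have Kv0 : K1 x *m u^T = 0.
  by rewrite -[K1 x]trmxK -trmx_mul uK0 trmx0.
move: u^T Kv0 => v Kv0.
apply: (full_rank_orthogonal_eq0 hfull) => i.
have sq0 : \sum_(i < N) (\sum_(k < p) v k 0 * x i k 0) ^+ 2 = 0.
  transitivity (\sum_(j < p) v j 0 * (N%:R * (K1 x *m v) j 0)); last first.
    by rewrite big1 // => j _; rewrite Kv0 mxE !mulr0.
  under [RHS]eq_bigr do rewrite K1_mulE ?(full_rank_gt0 hfull) // mulr_sumr.
  rewrite exchange_big /=; apply: eq_bigr => k _.
  rewrite expr2 mulr_sumr.
  by apply: eq_bigr => j _; rewrite mulrCA.
apply/eqP; rewrite -sqrf_eq0; apply/eqP.
by apply: (psumr_eq0P _ sq0) => // k _; rewrite sqr_ge0.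
Qed.

(** Cramer's rule: the inverse is the transposed cofactor matrix divided by the determinant. *)
Lemma beta_line_coordE {R : realType} {p N : nat} {x : 'I_N -> 'cV[R]_p}
    {y : 'I_N -> R} (delta : 'cV[R]_p) (s : R) (a : 'I_p) :
  full_rank x y ->
  beta_line x y delta s a 0 =
    betahat x y a 0 + s * (s_denom x delta a / \det (K1 x)).
Proof.
move=> /K1_unit uK; rewrite /beta_line mxE [X in _ + X]mxE; congr (_ + _ * _).
rewrite /invmx uK -scalemxAl mxE mulrC; congr (_ / _).
by rewrite mxE; apply: eq_bigr => j _; rewrite mxE.
Qed.

Lemma beta_line_eq0 {R : realType} {p N : nat} {x : 'I_N -> 'cV[R]_p}
    {y : 'I_N -> R} (delta : 'cV[R]_p) (s : R) (a : 'I_p) :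
  full_rank x y -> s_denom x delta a != 0 ->
  beta_line x y delta s a 0 = 0 <-> s = s_value x y delta a.
Proof.
move=> hfull d0; rewrite beta_line_coordE // /s_value.
have := K1_unit hfull; rewrite unitmxE unitfE => D0.
split=> [h | ->]; last by field; rewrite D0 d0.
have -> : betahat x y a 0 = - (s * (s_denom x delta a / \det (K1 x))).
  by apply/eqP; rewrite -addr_eq0 h.
by field; rewrite D0 d0.
Qed.

(** An affine function of s is fixed by its value at 0 and its nonzero root. In this form the
    coordinate keeps its sign as long as the factor is nonnegative. *)
Lemma beta_line_scale {R : realType} {p N : nat} {x : 'I_N -> 'cV[R]_p}
    {y : 'I_N -> R} (delta : 'cV[R]_p) (s : R) (a : 'I_p) :
  full_rank x y -> s_denom x delta a != 0 -> betahat x y a 0 != 0 ->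
  beta_line x y delta s a 0 = (1 - s / s_value x y delta a) * betahat x y a 0.
Proof.
move=> hfull d0 b0; rewrite beta_line_coordE // /s_value.
have := K1_unit hfull; rewrite unitmxE unitfE => D0.
by field; rewrite D0 d0 b0.
Qed.

Lemma sign_vectorE {R : realType} {p : nat} {delta beta : 'cV[R]_p} (j : 'I_p) :
  sign_vector delta beta -> delta j 0 * beta j 0 = `|beta j 0|.
Proof.
move=> /(_ j)[h _]; have [->|b0] := eqVneq (beta j 0) 0.
  by rewrite mulr0 normr0.
by rewrite h // normrEsg.
Qed.

Lemma sign_vector_le1 {R : realType} {p : nat} {delta beta : 'cV[R]_p}
    (j : 'I_p) : sign_vector delta beta -> `|delta j 0| <= 1.
Proof.
move=> /(_ j)[h0 h1]; have [/h1|/h0 ->] := eqVneq (beta j 0) 0; last first.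
  by rewrite normr_sg lern1; case: (_ != 0).
by rewrite !inE => /or3P[] /eqP ->; rewrite ?normrN ?normr1 ?normr0.
Qed.

(** Hölder's inequality for a vector of sup norm at most 1. *)
Lemma sign_vector_dot_le {R : realType} {p : nat} {delta beta : 'cV[R]_p} (gamma : 'cV[R]_p) :
  sign_vector delta beta -> \sum_(j < p) delta j 0 * gamma j 0 <= l1norm gamma.
Proof.
move=> hdelta; apply: ler_sum => j _; apply: le_trans (ler_norm _) _.
by rewrite normrM ler_piMl // (sign_vector_le1 _ hdelta).
Qed.

(** Each coordinate still agrees in sign with [delta]. The hypothesis [hnondeg] excludes a
    coordinate that is zero at s = 0 and moves away from it, possibly against its sign in
    [delta]. *)
Lemma beta_line_l1normE {R : realType} {p N : nat} {x : 'I_N -> 'cV[R]_p}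
    {y : 'I_N -> R} {delta : 'cV[R]_p} {s : R} (hfull : full_rank x y)
    (hdelta : sign_vector delta (betahat x y))
    (hnondeg : forall a, s_denom x delta a != 0 -> betahat x y a 0 != 0) :
  s < 0 -> (forall a, s_value x y delta a < 0 -> s_value x y delta a < s) ->
  \sum_(j < p) delta j 0 * beta_line x y delta s j 0 =
    l1norm (beta_line x y delta s).
Proof.
move=> s0 hs; apply: eq_bigr => a _.
have [d0|d0] := eqVneq (s_denom x delta a) 0.
  by rewrite beta_line_coordE // d0 mul0r mulr0 addr0 sign_vectorE.
rewrite beta_line_scale ?hnondeg // normrM mulrCA sign_vectorE //.
congr (_ * _); rewrite ger0_norm // subr_ge0.
(* A negative root lies below s < 0, so the quotient is less than 1; for a nonnegative root the
   quotient is at most 0. *)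
have [sa0|sa0] := ltP (s_value x y delta a) 0.
  by rewrite ler_ndivrMr // mul1r ltW // hs.
by apply: le_trans ler01; rewrite mulr_le0_ge0 ?invr_ge0 // ltW.
Qed.

(** The left side is minus the j-th partial derivative of the loss at beta(s). *)
Lemma residual_beta_line {R : realType} {p N : nat} {x : 'I_N -> 'cV[R]_p}
    {y : 'I_N -> R} (delta : 'cV[R]_p) (s : R) (j : 'I_p) :
  full_rank x y ->
  \sum_(i < N) (y i - \sum_(k < p) beta_line x y delta s k 0 * x i k 0) * x i j 0
    = - (N%:R * s * delta j 0).
Proof.
move=> hfull; have uK := K1_unit hfull.
have N0 := full_rank_gt0 hfull.
have NR : (N%:R : R) != 0 by rewrite pnatr_eq0 -lt0n.
under eq_bigr do rewrite mulrBl.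
rewrite sumrB -K1_mulE // /beta_line /betahat mulmxDr -(scalemxAr s) !mulKVmx //.
rewrite !mxE mulrDr mulVKf // summxE.
under [X in _ - (X + _)]eq_bigr do rewrite mxE.
by rewrite opprD addNKr mulrA.
Qed.

Lemma lasso_loss_beta_lineE {R : realType} {p N : nat} {x : 'I_N -> 'cV[R]_p}
    {y : 'I_N -> R} (delta : 'cV[R]_p) (s : R) (gamma : 'cV[R]_p) :
  let beta := beta_line x y delta s in
  full_rank x y ->
  lasso_loss x y gamma = lasso_loss x y beta +
    N%:R * s * (\sum_(j < p) delta j 0 * gamma j 0 -
                \sum_(j < p) delta j 0 * beta j 0) +
    2^-1 * \sum_(i < N) (\sum_(j < p) (gamma - beta) j 0 * x i j 0) ^+ 2.
Proof.
move=> beta hfull.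
(* Cross term of the squares, with each residual at gamma written as the residual at beta minus
   <x_i, gamma - beta>. *)
have cross : \sum_(i < N) (y i - \sum_(k < p) beta k 0 * x i k 0) *
      (\sum_(j < p) (gamma - beta) j 0 * x i j 0) =
    - (N%:R * s * (\sum_(j < p) delta j 0 * gamma j 0 -
                   \sum_(j < p) delta j 0 * beta j 0)).
  under eq_bigr do rewrite mulr_sumr.
  rewrite exchange_big /= -sumrB mulr_sumr -sumrN; apply: eq_bigr => j _.
  under eq_bigr do rewrite mulrCA.
  rewrite -mulr_sumr residual_beta_line // !mxE; ring.
rewrite -[_ * _ * (_ - _)]opprK -cross /lasso_loss.
rewrite -sumrN mulr_sumr [X in _ = X + _ + _]mulr_sumr [X in _ + X]mulr_sumr.
rewrite -!big_split /=; apply: eq_bigr => i _.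
have -> : \sum_(j < p) (gamma - beta) j 0 * x i j 0 =
    \sum_(j < p) gamma j 0 * x i j 0 - \sum_(j < p) beta j 0 * x i j 0.
  by rewrite -sumrB; apply: eq_bigr => j _; rewrite !mxE mulrBl.
by field.
Qed.

Theorem theorem3p3 (R : realType) (p N : nat) (hp : (2 <= p)%N)
    (x : 'I_N -> 'cV[R]_p) (y : 'I_N -> R)
    (hcent : centered x y) (hfull : full_rank x y)
    (delta : 'cV[R]_p) (hdelta : sign_vector delta (betahat x y))
    (hnondeg : forall alpha : 'I_p,
       s_denom x delta alpha != 0 -> betahat x y alpha 0 != 0) :
  (forall alpha : 'I_p, s_denom x delta alpha != 0 ->
     forall s : R,
       beta_line x y delta s alpha 0 = 0 <-> s = s_value x y delta alpha) /\
  (forall I : 'I_p,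
     s_value x y delta I < 0 ->
     (forall alpha : 'I_p, s_value x y delta alpha < 0 ->
        `|s_value x y delta I| <= `|s_value x y delta alpha|) ->
     forall s : R, s_value x y delta I < s -> s < 0 ->
     forall t : R, l1norm (beta_line x y delta s) = t ->
       lasso_solution x y t (beta_line x y delta s)).
Proof.
split=> [a d0 s|I I0 Imin s Is s0 t bt]; first exact: beta_line_eq0.
(* Among negative numbers the least absolute value belongs to the greatest, so s_I bounds all
   negative roots from above. *)
have hs a : s_value x y delta a < 0 -> s_value x y delta a < s.
  move=> a0; apply: le_lt_trans Is; have := Imin a a0.
  by rewrite !ltr0_norm // lerN2.
have dt := beta_line_l1normE hfull hdelta hnondeg s0 hs.
rewrite bt in dt.
have lin_ge0 (gamma : 'cV[R]_p) : l1norm gamma <= t ->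
    0 <= N%:R * s * (\sum_(j < p) delta j 0 * gamma j 0 - t).
  move=> gt; rewrite mulr_le0 // ?subr_le0.
    by rewrite mulr_ge0_le0 // ltW.
  exact: le_trans (sign_vector_dot_le _ hdelta) gt.
have sq_ge0 (v : 'cV[R]_p) (i : 'I_N) :
    true -> 0 <= (\sum_(j < p) v j 0 * x i j 0) ^+ 2.
  by rewrite sqr_ge0.
have quad_ge0 (v : 'cV[R]_p) :
    0 <= \sum_(i < N) (\sum_(j < p) v j 0 * x i j 0) ^+ 2.
  by apply: sumr_ge0; exact: sq_ge0.
split=> [|gamma [gt gmin]].
  split=> [|gamma gt]; first by rewrite bt.
  rewrite (lasso_loss_beta_lineE delta s gamma) // dt.
  have := lin_ge0 _ gt; have := quad_ge0 (gamma - beta_line x y delta s); lra.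
(* Uniqueness: beta(s) is admissible, so a minimizer gamma has no larger loss, and both nonnegative
   terms of the expansion must vanish. *)
have bt_le : l1norm (beta_line x y delta s) <= t by rewrite bt.
have := gmin _ bt_le.
rewrite (lasso_loss_beta_lineE delta s gamma) // dt => loss_le.
have quad_eq0 : \sum_(i < N) (\sum_(j < p)
    (gamma - beta_line x y delta s) j 0 * x i j 0) ^+ 2 = 0.
  have := lin_ge0 _ gt; have := quad_ge0 (gamma - beta_line x y delta s); lra.
apply/esym/eqP; rewrite -subr_eq0; apply/eqP.
apply: (full_rank_orthogonal_eq0 hfull) => i.
apply/eqP; rewrite -sqrf_eq0; apply/eqP.
exact: (psumr_eq0P (sq_ge0 _) quad_eq0).
Qed.
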